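(* Let $X$ be a diffeological space. The map $\imath:X\rightarrow\mathfrak{P}_{u}(X)$ defined by $\imath(x)=\{x\}$ is a strong embedding.
   Context: A parametrization in a set $X$ is a map $P:U\to X$ with $U$ an open subset of some $\mathbb{R}^n$. A diffeology on $X$ is a set of parametrizations in $X$ (called plots) that contains all constant parametrizations, is local, and is stable under precomposition with smooth maps between open subsets of Euclidean spaces. A map $f$ between diffeological spaces is smooth if $f\circ P$ is a plot for every plot $P$. A subset is D-open if its preimage under every plot is open; the D-open sets form the D-topology. Subsets carry the subset diffeology and products the product diffeology. $\mathfrak{P}(X)$ is the set of all subsets of $X$. Union power set diffeology: $P:U\to\mathfrak{P}(X)$ is a plot of $\mathfrak{P}_u(X)$ iff there is a family of parametrizations $P_i:U_i\to\mathfrak{P}(X)$ ($i\in J$, $U_i$ open in the same Euclidean space, $U=\bigcup_i U_i$), each either constant with value $\emptyset$ or of the form $r\mapsto\{p_i(r)\}$ for a plot $p_i:U_i\to X$, such that $P(r)=\bigcup\{P_i(r)\mid i\in J,\ r\in U_i\}$ for all $r\in U$. Equivalently: for every $r_0\in U$ and $x_0\in P(r_0)$ there exist an open neighborhood $V\subset U$ of $r_0$ and a plot $\sigma:V\to X$ with $\sigma(r)\in P(r)$ for all $r\in V$ and $\sigma(r_0)=x_0$. An induction is an injective map $f:X\to Y$ such that a parametrization $P$ in $X$ is a plot iff $f\circ P$ is a plot in $Y$. For a smooth map $f:X\to Y$ and a plot $P:U\to Y$, let $P^*X=\{(r,x)\in U\times X\mid P(r)=f(x)\}$ and $P^*f:P^*X\to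 U$, $(r,x)\mapsto r$. A smooth map $f:X\to Y$ is a diffeological immersion if for every plot $P:U\to Y$ and every $(r_0,x_0)\in P^*X$ there exist a D-open neighborhood $O$ of $(r_0,x_0)$ in $P^*X$, an open neighborhood $V\subset U$ of $P^*f(O)$, and a smooth map $\rho:V\to U\times X$ such that $\rho\circ P^*f(r,x)=(r,x)$ for all $(r,x)\in O$. A strong embedding is a map which is an induction, a diffeological immersion, and a D-embedding (i.e. a topological embedding with respect to the D-topologies). *)

(* Defs.v *)
From HB Require Import structures.
From mathcomp Require Import all_boot all_order all_algebra.
From mathcomp Require Import all_classical all_reals all_analysis.
Import Order.TTheory GRing.Theory Num.Theory numFieldNormedType.Exports.

Set Implicit Arguments.
Unset Strict Implicit.
Unset Printing Implicit Defensive.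

Local Open Scope classical_set_scope.
Local Open Scope ring_scope.

Definition set_elt {T : Type} (A : set T) x (Ax : A x) : A :=
  exist (fun y => y \in A) x (mem_set Ax).

Definition set_incl {T : Type} (A B : set T) (AB : A `<=` B) (r : A) : B :=
  set_elt (AB _ (set_mem (valP r))).

Section smooth.
Context {R : realType}.

(* Meant for open U; the values of f outside U are then irrelevant, see
   [Ck_on_ext] below. *)
Fixpoint Ck_on {V W : normedModType R} (k : nat) (U : set V) (f : V -> W) :
    Prop :=
  if k is k'.+1 then
    (forall x, U x -> differentiable f x) /\ forall v, Ck_on k' U ('D_v f)
  else forall x, U x -> {for x, continuous f}.

Definition smooth_on {V W : normedModType R} (U : set V) (f : V -> W) :=
  forall k, Ck_on k U f.

Section calculus.
Context {V : normedModType R}.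
Implicit Types (U : set V).

Lemma near_eq_diff (W : normedModType R) (f g : V -> W) x :
  (\forall y \near x, f y = g y) -> differentiable f x ->
  'd g x = 'd f x :> (V -> W) /\ differentiable g x.
Proof.
move=> fg df; have fgx : f x = g x := nbhs_singleton fg.
have dfc : continuous ('d f x) by exact: diff_continuous.
have E : g \o shift x = cst (g x) + 'd f x +o_ 0 id.
  apply/eqaddoP => e e0.
  have /eqaddoP /(_ e e0) := diff_locally df.
  have : \forall y \near 0, f (y + x) = g (y + x).
    by move: fg; rewrite (near_shift 0 x) /= subr0.
  by apply: filterS2 => y Hy /=; rewrite !fctE /= -Hy fgx.
have D := diff_unique dfc E.
split; first exact: D.
by apply/diff_locallyP; rewrite D; split; [exact: dfc|exact: E].
Qed.

Lemma open_near_eq (W : Type) U (f g : V -> W) x : open U ->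
  (forall y, U y -> f y = g y) -> U x -> \forall y \near x, f y = g y.
Proof.
by move=> oU fg Ux; apply: filterS fg _; apply: open_nbhs_nbhs; split.
Qed.

Lemma Ck_on_ext (W : normedModType R) k U (f g : V -> W) : open U ->
  (forall x, U x -> f x = g x) -> Ck_on k U f -> Ck_on k U g.
Proof.
move=> oU; elim: k f g => [|k IH] f g fg /= fk.
  move=> x Ux; rewrite /prop_for /continuous_at -(fg x Ux).
  apply: cvg_trans (fk x Ux); apply: near_eq_cvg.
  exact: open_near_eq oU fg Ux.
have H x : U x -> 'd g x = 'd f x :> (V -> W) /\ differentiable g x.
  by move=> Ux; apply: near_eq_diff; [exact: open_near_eq oU fg Ux|exact: fk.1].
split=> [x /H[]//|v]; apply: IH (fk.2 v) => x Ux.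
have [E dg] := H x Ux.
by rewrite (deriveE v dg) E (deriveE v (fk.1 x Ux)).
Qed.

Lemma Ck_onS (W : normedModType R) k U (f : V -> W) :
  Ck_on k.+1 U f -> Ck_on k U f.
Proof.
elim: k f => [|k IH] f [fd fk].
  by move=> x Ux; exact/differentiable_continuous/fd.
by split=> // v; exact: IH.
Qed.

Lemma Ck_on_sub (W : normedModType R) k U U' (f : V -> W) :
  U' `<=` U -> Ck_on k U f -> Ck_on k U' f.
Proof.
move=> sU; elim: k f => [|k IH] f /=; first by move=> fk x /sU; exact: fk.
by move=> [fd fk]; split=> [x /sU Ux|v]; [exact: fd x Ux|exact: IH (fk v)].
Qed.

Lemma Ck_on_local (W : normedModType R) k U (f : V -> W) :
  (forall x, U x -> exists2 U', U' x & Ck_on k U' f) -> Ck_on k U f.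
Proof.
elim: k f => [|k IH] f /= fl.
  by move=> x /fl[U' U'x]; exact.
split=> [x /fl[U' U'x] []|v]; first by move=> + _; exact.
by apply: IH => x /fl[U' U'x] [_ fk]; exists U'.
Qed.

Lemma Ck_on_cst (W : normedModType R) k U (c : W) : Ck_on k U (cst c).
Proof.
elim: k c => [|k IH] c /=; first by move=> x _; exact: cvg_cst.
split=> [x _|v]; first exact: differentiable_cst.
have -> : 'D_v (cst c) = cst (0 : W) by apply/funext => x; rewrite derive_cst.
exact: IH.
Qed.

Lemma Ck_onD (W : normedModType R) k U (f g : V -> W) : open U ->
  Ck_on k U f -> Ck_on k U g -> Ck_on k U (f + g).
Proof.
move=> oU; elim: k f g => [|k IH] f g /=.
  by move=> fc gc x Ux; apply: continuousD; [exact: fc|exact: gc].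
move=> [fd fk] [gd gk]; split=> [x Ux|v].
  by apply: differentiableD; [exact: fd|exact: gd].
apply: Ck_on_ext (IH _ _ (fk v) (gk v)) => // x Ux.
by rewrite deriveD//; apply: diff_derivable; [exact: fd|exact: gd].
Qed.

Lemma Ck_on_sum (W : normedModType R) k U n (f : 'I_n -> V -> W) : open U ->
  (forall i, Ck_on k U (f i)) -> Ck_on k U (\sum_i f i).
Proof.
move=> oU fk; elim/big_ind : _ => //; first exact: Ck_on_cst.
by move=> g h; exact: Ck_onD.
Qed.

Lemma Ck_on_lin (W W' : normedModType R) (L : {linear W -> W'}) k U
    (f : V -> W) : open U -> continuous L ->
  Ck_on k U f -> Ck_on k U (L \o f).
Proof.
move=> oU cL; elim: k f => [|k IH] f /=.
  by move=> fc x Ux; apply: continuous_comp; [exact: fc|exact: cL].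
move=> [fd fk]; have dL y : differentiable L y by exact: linear_differentiable.
split=> [x Ux|v]; first by apply: differentiable_comp => //; exact: fd.
apply: Ck_on_ext (IH _ (fk v)) => // x Ux.
have dLf : differentiable (L \o f) x.
  by apply: differentiable_comp; [exact: fd|exact: dL].
rewrite (deriveE v dLf) (diff_comp (fd x Ux) (dL _)) /= (diff_lin _ cL).
by rewrite (deriveE v (fd x Ux)).
Qed.

Lemma Ck_onM k U (f g : V -> R) : open U ->
  Ck_on k U f -> Ck_on k U g -> Ck_on k U (f * g).
Proof.
move=> oU; elim: k f g => [|k IH] f g fk gk.
  by move=> x Ux; apply: continuousM; [exact: fk|exact: gk].
have [fd fk'] := fk; have [gd gk'] := gk.
split=> [x Ux|v]; first by apply: differentiableM; [exact: fd|exact: gd].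
pose h := f * 'D_v g + g * 'D_v f.
apply: (@Ck_on_ext _ _ _ h) => // [x Ux|].
  by rewrite deriveM//; apply: diff_derivable; [exact: fd|exact: gd].
apply: (Ck_onD oU).
  exact: IH (Ck_onS fk) (gk' v).
exact: IH (Ck_onS gk) (fk' v).
Qed.

End calculus.

Lemma Ck_on_row {V : normedModType R} k (U : set V) m (f : V -> 'rV[R]_m) :
  open U ->
  (forall j, Ck_on k U (fun x => f x ord0 j)) -> Ck_on k U f.
Proof.
move=> oU fk.
have -> : f = \sum_j (fun x => f x ord0 j *: delta_mx ord0 j).
  apply/funext => x; rewrite fct_sumE. exact: row_sum_delta.
apply: Ck_on_sum => // j.
pose d : 'rV[R]_m := delta_mx ord0 j.
have lin : linear (fun t : R => t *: d).
  by move=> a u v; rewrite scalerDl scalerA.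
pose LM := GRing.isLinear.Build _ _ _ _ _ lin.
pose L : {linear R -> 'rV[R]_m} := HB.pack (fun t : R => t *: d) LM.
have cL : continuous L by exact: scalel_continuous.
exact: (Ck_on_lin oU cL (fk j)).
Qed.

Lemma Ck_on_coord {V : normedModType R} k (U : set V) m (f : V -> 'rV[R]_m) j :
  open U -> Ck_on k U f -> Ck_on k U (fun x => f x ord0 j).
Proof.
move=> oU fk.
have lin : linear (fun N : 'rV[R]_m => N ord0 j : R).
  by move=> a u v; rewrite !mxE.
pose LM := GRing.isLinear.Build _ _ _ _ _ lin.
pose L : {linear 'rV[R]_m -> R} := HB.pack (fun N : 'rV[R]_m => N ord0 j : R) LM.
have cL : continuous L by exact: coord_continuous.
exact: (Ck_on_lin oU cL fk).
Qed.

Lemma Ck_on_comp1 {V : normedModType R} m k (U : set V) (U' : set 'rV[R]_m)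
    (g : 'rV[R]_m -> R) (f : V -> 'rV[R]_m) : open U ->
  (forall x, U x -> U' (f x)) ->
  Ck_on k U' g -> Ck_on k U f -> Ck_on k U (g \o f).
Proof.
move=> oU sU; elim: k g => [|k IH] g gk fk.
  by move=> x Ux; apply: continuous_comp; [exact: fk|exact/gk/sU].
have [gd gk'] := gk; have [fd fk'] := fk.
have gfd x : U x -> differentiable (g \o f) x.
  by move=> Ux; apply: differentiable_comp; [exact: fd|exact/gd/sU].
split=> // v.
pose h := \sum_j (fun x => 'D_v f x ord0 j) * ('D_(delta_mx ord0 j) g \o f).
apply: (@Ck_on_ext _ _ _ _ h) => // [x Ux|].
  have dg : differentiable g (f x) by exact/gd/sU.
  rewrite /h fct_sumE (deriveE v (gfd x Ux)) (diff_comp (fd x Ux) dg) /=.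
  rewrite -(deriveE v (fd x Ux)) [in RHS](row_sum_delta ('D_v f x)) linear_sum.
  by apply: eq_bigr => j _; rewrite linearZ /= !fctE /= (deriveE _ dg).
apply: (Ck_on_sum oU) => j; apply: (Ck_onM oU).
  exact: (Ck_on_coord j oU (fk' v)).
exact: IH (gk' _) (Ck_onS fk).
Qed.

Lemma Ck_on_comp {V : normedModType R} m p k (U : set V) (U' : set 'rV[R]_m)
    (g : 'rV[R]_m -> 'rV[R]_p) (f : V -> 'rV[R]_m) : open U -> open U' ->
  (forall x, U x -> U' (f x)) ->
  Ck_on k U' g -> Ck_on k U f -> Ck_on k U (g \o f).
Proof.
move=> oU oU' sU gk fk; apply: Ck_on_row => // j.
exact: (@Ck_on_comp1 _ _ _ _ U' (fun y => g y ord0 j)) (Ck_on_coord j oU' gk) fk.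
Qed.

(* For U open, smoothness of P does not depend on the extension g. *)
Definition smooth_param n m (U : set 'rV[R]_n) (P : U -> 'rV[R]_m) :=
  exists2 g : 'rV[R]_n -> 'rV[R]_m,
    smooth_on U g & forall r : U, P r = g (val r).

End smooth.

(* The parametrizations in X are the maps P : U -> X, U being coerced to the
   type of its elements, so that the empty parametrization exists even if X is
   empty.  The missing half of locality, stability under restriction to open
   subsets, is the case of [plot_comp] where F is an inclusion. *)
Record diffeology (R : realType) (X : Type) := Diffeology {
  plot :> forall n (U : set 'rV[R]_n), (U -> X) -> Prop ;
  plot_open : forall n (U : set 'rV[R]_n) (P : U -> X), plot P -> open U ;
  plot_cst : forall n (U : set 'rV[R]_n) (x : X), open U ->
    plot (fun _ : U => x) ;
  plot_local : forall n (U : set 'rV[R]_n) (P : U -> X), open U ->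
    (forall r0 : U, exists (V : set 'rV[R]_n) (VU : V `<=` U),
      [/\ open V, V (val r0) & plot (P \o set_incl VU)]) ->
    plot P ;
  plot_comp : forall n (U : set 'rV[R]_n) (P : U -> X)
      m (V : set 'rV[R]_m) (F : V -> U), plot P -> open V ->
    smooth_param (fun r => val (F r)) -> plot (P \o F)
}.
Arguments plot {R X} _ {n U} P.

Section constructions.
Context {R : realType}.

Section euclidean.
Variable k : nat.

Definition euclidean_plot n (U : set 'rV[R]_n) (P : U -> 'rV[R]_k) :=
  open U /\ smooth_param P.

Lemma euclidean_plot_cst n (U : set 'rV[R]_n) (x : 'rV[R]_k) : open U ->
  euclidean_plot (fun _ : U => x).
Proof.
by move=> oU; split=> //; exists (cst x) => // l; exact: Ck_on_cst.
Qed.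

Lemma euclidean_plot_local n (U : set 'rV[R]_n) (P : U -> 'rV[R]_k) : open U ->
  (forall r0 : U, exists (V : set 'rV[R]_n) (VU : V `<=` U),
    [/\ open V, V (val r0) & euclidean_plot (P \o set_incl VU)]) ->
  euclidean_plot P.
Proof.
move=> oU Pl; split=> //.
pose g (r : 'rV[R]_n) : 'rV[R]_k :=
  if pselect (U r) is left Ur then P (set_elt Ur) else 0.
have gE (r : U) : P r = g (val r).
  rewrite /g; case: pselect => [Ur|]; last by have /set_mem := valP r.
  by congr P; exact: val_inj.
exists g => // l; apply: Ck_on_local => x Ux.
have [V [VU [oV Vx [_ [h hs hE]]]]] := Pl (set_elt Ux).
exists V => //; apply: Ck_on_ext (hs l) => // y Vy.
have := hE (set_elt Vy); rewrite /= => <-.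
by rewrite gE.
Qed.

Lemma euclidean_plot_comp n (U : set 'rV[R]_n) (P : U -> 'rV[R]_k)
    m (V : set 'rV[R]_m) (F : V -> U) : euclidean_plot P -> open V ->
  smooth_param (fun r => val (F r)) -> euclidean_plot (P \o F).
Proof.
move=> [oU [g gs gE]] oV [f fs fE]; split=> //.
exists (g \o f); last by move=> r; rewrite /= gE fE.
move=> l; apply: (@Ck_on_comp _ _ _ _ _ _ U) => // x Vx.
by have := fE (set_elt Vx); rewrite /= => <-; exact/set_mem/valP.
Qed.

Definition euclidean_diffeology : diffeology R 'rV[R]_k :=
  Diffeology (fun n U P (h : euclidean_plot P) => h.1) euclidean_plot_cst
    euclidean_plot_local euclidean_plot_comp.

End euclidean.

Section subset.
Context {X : Type} (D : diffeology R X) (A : set X).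

Definition subset_plot n (U : set 'rV[R]_n) (P : U -> A) :=
  plot D (fun r => val (P r)).

Definition subset_diffeology : diffeology R A.
Proof.
apply: (@Diffeology R A subset_plot).
- by move=> n U P; exact: plot_open.
- by move=> n U x oU; exact: plot_cst.
- by move=> n U P oU Pl; exact: plot_local.
- move=> n U P m V F; exact: (@plot_comp R X D n U (fun r => val (P r)) m V F).
Defined.

End subset.

Section product.
Context {X Y : Type} (DX : diffeology R X) (DY : diffeology R Y).

Definition product_plot n (U : set 'rV[R]_n) (P : U -> X * Y) :=
  plot DX (fun r => (P r).1) /\ plot DY (fun r => (P r).2).

Definition product_diffeology : diffeology R (X * Y)%type.
Proof.
apply: (@Diffeology R (X * Y)%type product_plot).
- by move=> n U P [/plot_open].
- by move=> n U [x y] oU; split; exact: plot_cst.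
- move=> n U P oU Pl; split; apply: plot_local => // r0;
    have [V [VU [oV Vr0 [P1 P2]]]] := Pl r0; by exists V, VU.
- move=> n U P m V F [P1 P2] oV Fs; split.
    exact: (@plot_comp _ _ _ _ _ (fun r => (P r).1) _ V F).
  exact: (@plot_comp _ _ _ _ _ (fun r => (P r).2) _ V F).
Defined.

End product.

Section union_powerset.
Context {X : Type} (D : diffeology R X).

Definition union_plot n (U : set 'rV[R]_n) (P : U -> set X) : Prop :=
  open U /\
  exists (J : Type) (V : J -> set 'rV[R]_n) (Q : forall i, V i -> set X),
    [/\ U = \bigcup_i V i,
        forall i, open (V i),
        forall i, Q i = (fun=> set0) \/
          exists2 p : V i -> X, plot D p & Q i = (fun r => [set p r])
      & forall r : U, P r =
          [set x | exists i, exists2 s : V i, val s = val r & Q i s x] ].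

Lemma union_plotP n (U : set 'rV[R]_n) (P : U -> set X) : open U ->
  union_plot P <->
  forall (r0 : U) (x0 : X), P r0 x0 ->
    exists (V : set 'rV[R]_n) (VU : V `<=` U) (sigma : V -> X),
      [/\ plot D sigma, forall r, P (set_incl VU r) (sigma r)
        & exists2 r : V, val r = val r0 & sigma r = x0].
Proof.
move=> oU; split.
  move=> [_ [J [V [Q [UE oV QE PE]]]]] r0 x0; rewrite PE => -[i [s sr0 Qx0]].
  have VU : V i `<=` U by rewrite UE => x Vx; exists i.
  have [Q0|[p pD Qp]] := QE i; first by rewrite Q0 in Qx0.
  rewrite Qp /= in Qx0.
  exists (V i), VU, p; split=> //.
    by move=> r; rewrite PE /=; exists i; exists r; rewrite ?Qp.
  by exists s.
move=> H; split=> //.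
pose J := option {V : set 'rV[R]_n & {VU : V `<=` U & {s : V -> X |
  plot D s /\ forall r, P (set_incl VU r) (s r)}}}.
pose W (i : J) : set 'rV[R]_n := if i is Some i then projT1 i else U.
pose Q (i : J) : W i -> set X :=
  match i return W i -> set X with
  | Some i => fun r => [set proj1_sig (projT2 (projT2 i)) r]
  | None => fun=> set0
  end.
exists J, W, Q; split.
- apply/seteqP; split=> [x Ux|x [[[V [VU s]]|] _ //=]]; first by exists None.
  exact: VU.
- by move=> [[V [VU [s [sD sP]]]]|//]; exact: plot_open sD.
- move=> [[V [VU [s [sD sP]]]]|]; last by left.
  by right; exists s.
- move=> r; apply/seteqP; split=> [x Prx|x [[[V [VU [s [sD sP]]]]|] []//]].
    have [V [VU [s [sD sP [r' r'E sx]]]]] := H r x Prx.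
    exists (Some (existT _ V (existT _ VU (exist _ s (conj sD sP))))).
    by exists r'.
  move=> r' r'E /= ->; have := sP r'.
  by congr (P _ _); exact: val_inj.
Qed.

Lemma union_plot_cst n (U : set 'rV[R]_n) (A : set X) : open U ->
  union_plot (fun _ : U => A).
Proof.
move=> oU; apply/union_plotP => // r0 x0 Ax0.
exists U, (@subset_refl _ U), (fun=> x0); split=> //; first exact: plot_cst.
by exists r0.
Qed.

Lemma union_plot_local n (U : set 'rV[R]_n) (P : U -> set X) : open U ->
  (forall r0 : U, exists (V : set 'rV[R]_n) (VU : V `<=` U),
    [/\ open V, V (val r0) & union_plot (P \o set_incl VU)]) ->
  union_plot P.
Proof.
move=> oU Pl; apply/union_plotP => // r0 x0 Px0.
have [V [VU [oV Vr0 /(union_plotP _ oV) H]]] := Pl r0.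
have E : set_incl VU (set_elt Vr0) = r0 by exact: val_inj.
have [|W [WV [s [sD sP [r rE sx]]]]] := H (set_elt Vr0) x0.
  by rewrite /= E.
exists W, (subset_trans WV VU), s; split=> //; last by exists r.
by move=> t; have := sP t; rewrite /=; congr (P _ _); exact: val_inj.
Qed.

Lemma union_plot_comp n (U : set 'rV[R]_n) (P : U -> set X)
    m (V : set 'rV[R]_m) (F : V -> U) : union_plot P -> open V ->
  smooth_param (fun r => val (F r)) -> union_plot (P \o F).
Proof.
move=> Pu oV Fs; have oU := Pu.1; move/(union_plotP _ oU) : Pu => Pu.
apply/union_plotP => // r0 x0 /Pu[W [WU [s [sD sP [w wE sx]]]]].
have [f fs fE] := Fs.
pose V' : set 'rV[R]_m := [set r | V r /\ W (f r)].
have oV' : open V'.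
  have oW := plot_open sD.
  rewrite openE => r [Vr Wfr]; rewrite /interior /=.
  apply: filterI; first exact: open_nbhs_nbhs.
  have cf : {for r, continuous f} by exact: (fs 0%N).
  by apply: cf; exact: open_nbhs_nbhs.
have V'V : V' `<=` V by move=> r [].
have WF (r : V') : W (f (val r)) by case/set_mem : (valP r).
pose G (r : V') : W := set_elt (WF r).
have V'r0 : V' (val r0).
  split; first exact/set_mem/valP.
  by rewrite -fE -wE; exact/set_mem/valP.
exists V', V'V, (s \o G); split.
- apply: plot_comp => //; exists f => //.
  by move=> l; exact: Ck_on_sub (fs l).
- move=> r; have := sP (G r); rewrite /=; congr (P _ _); apply: val_inj => /=.
  by rewrite fE.
- exists (set_elt V'r0) => //=; rewrite -sx; congr s; apply: val_inj => /=.
  by rewrite wE fE.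
Qed.

Definition union_diffeology : diffeology R (set X) :=
  Diffeology (fun n U P (h : union_plot P) => h.1) union_plot_cst
    union_plot_local union_plot_comp.

End union_powerset.

Definition smooth {X Y : Type} (DX : diffeology R X) (DY : diffeology R Y)
    (f : X -> Y) : Prop :=
  forall n (U : set 'rV[R]_n) (P : U -> X), plot DX P -> plot DY (f \o P).

Definition D_open {X : Type} (D : diffeology R X) (A : set X) : Prop :=
  forall n (U : set 'rV[R]_n) (P : U -> X), plot D P ->
    open (P @^-1` A : set U).

Definition Dtop {X : Type} (D : diffeology R X) : Type := X.

End constructions.

Section D_topology.
Context {R : realType} {X : Type} (D : diffeology R X).

HB.instance Definition _ := gen_eqMixin (Dtop D).
HB.instance Definition _ := gen_choiceMixin (Dtop D).

Lemma D_openT : D_open D setT.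
Proof. by move=> n U P _; rewrite preimage_setT; exact: openT. Qed.

Lemma D_openI : setI_closed (D_open D).
Proof.
by move=> A B oA oB n U P PD; rewrite preimage_setI; apply: openI; auto.
Qed.

Lemma D_open_bigU (I : Type) (f : I -> set X) :
  (forall i, D_open D (f i)) -> D_open D (\bigcup_i f i).
Proof.
move=> fo n U P PD; rewrite preimage_bigcup.
by apply: bigcup_open => i _; exact: fo.
Qed.

HB.instance Definition _ :=
  isOpenTopological.Build (Dtop D) D_openT D_openI D_open_bigU.

Lemma Dtop_openE (A : set (Dtop D)) : open A = D_open D A.
Proof. by []. Qed.

End D_topology.

Section maps.
Context {R : realType} {X Y : Type}.
Variables (DX : diffeology R X) (DY : diffeology R Y).

Definition induction (f : X -> Y) : Prop :=
  injective f /\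
  forall n (U : set 'rV[R]_n) (P : U -> X), open U ->
    plot DX P <-> plot DY (f \o P).

Definition D_embedding (f : X -> Y) : Prop :=
  [/\ injective f,
      continuous (f : Dtop DX -> Dtop DY)
    & forall A : set (Dtop DX), open A ->
        open (f @` A : set (subspace (range f : set (Dtop DY))))].

Definition domain_diffeology n (U : set 'rV[R]_n) : diffeology R U :=
  subset_diffeology (euclidean_diffeology n) U.

Definition pullback (f : X -> Y) n (U : set 'rV[R]_n) (P : U -> Y) :
  set (U * X) := [set rx | P rx.1 = f rx.2].

Definition pullback_diffeology (f : X -> Y) n (U : set 'rV[R]_n) (P : U -> Y) :
    diffeology R (pullback f P) :=
  subset_diffeology (product_diffeology (domain_diffeology U) DX) (pullback f P).

Definition pullback_map (f : X -> Y) n (U : set 'rV[R]_n) (P : U -> Y)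
  (z : pullback f P) : U := (val z).1.

Definition diffeological_immersion (f : X -> Y) : Prop :=
  smooth DX DY f /\
  forall n (U : set 'rV[R]_n) (P : U -> Y), plot DY P ->
  forall z0 : pullback f P,
  exists O : set (pullback f P),
    [/\ D_open (pullback_diffeology f P) O, O z0 &
    exists (V : set 'rV[R]_n)
      (OV : forall z, O z -> V (val (pullback_map z)))
      (rho : V -> U * X),
    [/\ open V, V `<=` U,
        smooth (domain_diffeology V)
          (product_diffeology (domain_diffeology U) DX) rho
      & forall z (Oz : O z), rho (set_elt (OV z Oz)) = val z]].

Definition strong_embedding (f : X -> Y) : Prop :=
  [/\ induction f, diffeological_immersion f & D_embedding f].

End maps.

(* Main.v *)
Require Import Defs.
From mathcomp Require Import all_boot all_order all_algebra.
From mathcomp Require Import all_classical all_reals all_analysis.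

Import numFieldNormedType.Exports.
Local Open Scope classical_set_scope.

(** Everything rests on the local sections in [union_plotP]: a section of
   r |-> {p r} must be p itself.  For the D-embedding, if A is D-open, then so
   is the set of all S meeting A (move along a section through a point of
   S `&` A), and its trace on the singletons is the image of A. *)

(** [U] as a type carries the initial topology of its inclusion into [T], so [A] must be the trace
    of one open set of [T]. The union of all open sets with trace inside [A] serves, with no choice
    of one per point. *)
Lemma open_set_type (T : topologicalType) (U : set T) (A : set U) :
  (forall r, A r -> exists W : set T,
    [/\ open W, W (val r) & forall s : U, W (val s) -> A s]) ->
  open A.
Proof.
move=> HA; exists (\bigcup_(W in [set W : set T |
    open W /\ forall s : U, W (val s) -> A s]) W).
  by apply: bigcup_open => W [].
apply/seteqP; split=> [r [W [_ WA] Wr]|r /HA[W [oW Wr WA]]]; first exact: WA.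
by exists W.
Qed.

Lemma open_D_open_euclidean (R : realType) k (V : set 'rV[R]_k) :
  open V -> D_open (euclidean_diffeology k) V.
Proof.
move=> oV n U P [oU [g gs gE]]; apply: open_set_type => r Vr.
(* The extension [g] is known to be continuous only at points of [U], hence the intersection with
   [U]. *)
exists [set x | U x /\ V (g x)]; split.
- rewrite openE => x [Ux Vgx]; apply: filterI; first exact: open_nbhs_nbhs.
  by apply: (gs 0%N x Ux); exact: open_nbhs_nbhs.
- by split; [exact/set_mem/valP|rewrite -gE].
- by move=> s [_]; rewrite -gE.
Qed.

Section singleton.
Context {R : realType} {X : Type} (D : diffeology R X).

Lemma plot_singleton n (U : set 'rV[R]_n) (P : U -> X) : plot D P ->
  plot (union_diffeology D) (fun r => [set P r]).
Proof.
move=> PD; have oU := plot_open PD; apply/union_plotP => // r0 x0 ->.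
exists U, (@subset_refl _ U), P; split=> // [r|]; last by exists r0.
by congr P; exact: val_inj.
Qed.

Lemma singleton_plot n (U : set 'rV[R]_n) (P : U -> X) :
  plot (union_diffeology D) (fun r => [set P r]) -> plot D P.
Proof.
move=> PD; have oU := plot_open PD; move/(union_plotP _ _ oU) : PD => PD.
apply: plot_local => // r0.
have [V [VU [s [sD sP [r rE _]]]]] := PD r0 (P r0) erefl.
exists V, VU; split; [exact: plot_open sD|by rewrite -rE; exact/set_mem/valP|].
by have <- : s = P \o set_incl VU by apply/funext => t; exact: sP.
Qed.

Lemma D_open_meets (A : set X) : D_open D A ->
  D_open (union_diffeology D) [set S | S `&` A !=set0].
Proof.
move=> oA n U P PD; have oU := plot_open PD.
move/(union_plotP _ _ oU) : PD => PD.
apply: open_set_type => r0 [x0 [Px0 Ax0]].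
have [V [VU [s [sD sP [r rE sx]]]]] := PD r0 x0 Px0.
have [W oW WE] := oA _ _ _ sD.
exists (V `&` W); split.
- by apply: openI => //; exact: plot_open sD.
- rewrite -rE; split; first exact/set_mem/valP.
  have : (s @^-1` A) r by rewrite /= sx.
  by rewrite -WE.
- move=> t [Vt Wt]; exists (s (set_elt Vt)); split.
    have := sP (set_elt Vt); congr (P _ _); exact: val_inj.
  by have : (set_val @^-1` W) (set_elt Vt) by []; rewrite WE.
Qed.

Lemma singleton_induction :
  induction D (union_diffeology D) (fun x : X => [set x]).
Proof.
split=> [x y /seteqP[/(_ x erefl)]//|n U P _].
by split; [exact: plot_singleton|exact: singleton_plot].
Qed.

Lemma singleton_smooth : smooth D (union_diffeology D) (fun x : X => [set x]).
Proof. by move=> n U P; exact: plot_singleton. Qed.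

(** A point of the pullback is a pair [(r, x)] with [P r = [set x]]. A section [s] of [P] over [V]
    must then satisfy [s r = x], so the graph map of [s] inverts the projection over [V]. *)
Lemma singleton_immersion :
  diffeological_immersion D (union_diffeology D) (fun x : X => [set x]).
Proof.
split=> [|n U P PD z0]; first exact: singleton_smooth.
have oU := plot_open PD; move/(union_plotP _ _ oU) : PD => PD.
have PE (z : pullback (fun x : X => [set x]) P) :
    P (val z).1 = [set (val z).2] by exact: set_mem (valP z).
have [|V [VU [s [sD sP [r rE sx]]]]] := PD (val z0).1 (val z0).2.
  by rewrite PE.
have oV := plot_open sD.
exists [set z | V (val (pullback_map z))]; split.
- by move=> m W Q [QU _]; exact: open_D_open_euclidean oV _ _ _ QU.
- by rewrite /= /pullback_map -rE; exact/set_mem/valP.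
(* This map is defined on all of [V], even where [P r] is not a singleton; only over [O] must it
   recover the pair. *)
- exists V, (fun z Oz => Oz), (fun r => (set_incl VU r, s r)); split=> //.
    move=> m W Q QV; split; first exact: QV.
    by apply: plot_comp => //; [exact: QV.1|exact: QV.2].
  move=> z Oz; set t := set_elt _.
  have E : set_incl VU t = (val z).1 by exact: val_inj.
  have := sP t; rewrite E PE => /= ->.
  by rewrite -surjective_pairing.
Qed.

Lemma singleton_D_embedding :
  D_embedding D (union_diffeology D) (fun x : X => [set x]).
Proof.
split=> [||A oA]; first by case: singleton_induction.
(* A smooth map is D-continuous, since it carries plots to plots. *)
- apply/continuousP => B oB; rewrite Dtop_openE => n U P PD.
  exact: oB _ _ _ (singleton_smooth _ _ _ PD).
- apply/open_subspaceP; exists [set S | S `&` A !=set0].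
    exact: D_open_meets oA.
  apply/seteqP; split=> S [SA Sx]; split=> //.
    by have [x _ xS] := Sx; move: SA; rewrite -xS => -[y [-> Ax]]; exists x.
  by have [x Ax <-] := SA; exists x.
Qed.

End singleton.

Theorem proposition3p8 (R : realType) (X : Type) (D : diffeology R X) :
  strong_embedding D (union_diffeology D) (fun x : X => [set x]).
Proof.
split; [exact: singleton_induction|exact: singleton_immersion|].
exact: singleton_D_embedding.
Qed.
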